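(* Let $M>0$ and let $\{X(i)\}_{i\ge 0}$ be i.i.d. exponentially distributed with probability density function $f(x)=\lambda e^{-\lambda x}$, $x\ge 0$, where $\lambda=1/\bar X$ and $\bar X=\mathbb{E}[X(i)]$. Put $\delta=\lambda M=M/\bar X$. Consider the infinite-capacity storage process $$B(i+1)=B(i)-M\,\mathds{1}_{B(i)>M}+X(i)$$ on $[0,\infty)$ and assume $M>\bar X$. Then the limiting probability density function of the energy buffer content $B(i)$ is $$g(x)=\begin{cases}\dfrac{1}{M}\left(1-e^{px}\right), & 0<x\le M,\\[2mm] \dfrac{-p}{M(\lambda+p)}\,e^{px}=\dfrac{-p}{\delta e^{pM}}\,e^{px}, & x>M,\end{cases}$$ where $p<0$ satisfies $\lambda e^{pM}=\lambda+p$ and is given by $$p=\frac{-\delta-W_0\!\left(-\delta e^{-\delta}\right)}{M}.$$ Furthermore, under the limiting distribution, the transmission probability is $\mathbb{P}(P_{\mathrm{UL}}(i)=M)=\dfrac{1}{\delta}$, where $P_{\mathrm{UL}}(i)=M\,\mathds{1}_{B(i)>M}$.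
   Context: $\mathds{1}_A$ equals $1$ if the event $A$ holds and $0$ otherwise. $W_0$ is the Lambert W function of order zero (the principal real branch of the inverse of $w\mapsto we^{w}$, with values in $[-1,\infty)$). The initial content is independent of the sequence $\{X(i)\}$, so $X(i)$ is independent of $B(i)$. A stationary distribution of a Markov chain is a distribution such that if the chain starts with this distribution, it remains in this distribution. A limiting distribution is a stationary distribution to which the chain converges asymptotically from some initial distribution. The limiting probability density function is the Lebesgue density of the limiting distribution of $B(i)$. In the case $M>\bar X$ the chain has a unique stationary distribution, it is absolutely continuous on $(0,\infty)$, and the chain converges to it in total variation from any initial distribution. *)

(* Defs.v *)
From HB Require Import structures.
From mathcomp Require Import all_boot all_order all_algebra.
From mathcomp Require Import finmap.
From mathcomp Require Import all_classical all_reals all_analysis.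
From mathcomp Require Import measurable_realfun.

Set Implicit Arguments.
Unset Strict Implicit.
Unset Printing Implicit Defensive.

Import Order.TTheory GRing.Theory Num.Theory.
Import numFieldNormedType.Exports.

Local Open Scope classical_set_scope.
Local Open Scope ring_scope.

(* Principal real branch, meaningful for -1/e <= x. Since w |-> w * e^w is
   injective on [-1, +oo[, the choice made by [xget] is then unique. *)
Definition lambertW0 (R : realType) (x : R) : R :=
  xget 0 [set w : R | -1 <= w /\ w * expR w = x].

Definition mutually_independent (R : realType) (d : measure_display)
    (Omega : measurableType d) (P : probability Omega R)
    (X : nat -> {RV P >-> R}) : Prop :=
  forall (J : {fset nat}) (A : nat -> set R), (forall i, measurable (A i)) ->
    P (\bigcap_(i in [set` J]) (X i @^-1` A i)) =
    (\prod_(i <- J) P (X i @^-1` A i))%E.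

Definition sigma_of_sequence (R : realType) (d : measure_display)
    (Omega : measurableType d) (X : nat -> Omega -> R) : set (set Omega) :=
  <<s [set D | exists i (A : set R), measurable A /\ D = X i @^-1` A] >>.

Definition independent_of_sequence (R : realType) (d : measure_display)
    (Omega : measurableType d) (P : probability Omega R)
    (Y : {RV P >-> R}) (X : nat -> {RV P >-> R}) : Prop :=
  forall (A : set R) (D : set Omega), measurable A -> sigma_of_sequence X D ->
    P (Y @^-1` A `&` D) = (P (Y @^-1` A) * P D)%E.

Definition has_pdf (R : realType) (mu : probability R R) (f : R -> R) : Prop :=
  [/\ measurable_fun setT f, forall x, 0 <= f x &
      forall A : set R, measurable A ->
        mu A = (\int[lebesgue_measure]_(x in A) (f x)%:E)%E].

Definition tv_dist (R : realType) (mu nu : probability R R) : R :=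
  sup [set r | exists A : set R, measurable A /\
                 r = `|fine (mu A) - fine (nu A)|].

Definition uplink_power (R : realType) (M b : R) : R := M * (M < b)%R%:R.

Definition storage_step (R : realType) (M b x : R) : R :=
  b - uplink_power M b + x.

Definition storage_step2 (R : realType) (M : R) (z : R * R) : R :=
  storage_step M z.1 z.2.

Lemma measurable_storage_step2 (R : realType) (M : R) :
  measurable_fun setT (@storage_step2 R M).
Proof.
apply: measurable_funD; last exact: measurable_snd.
apply: measurable_funB; first exact: measurable_fst.
apply: measurable_funM; first exact: measurable_cst.
have mnat : measurable_fun setT (fun b : bool => b%:R : R) by [].
apply: (measurableT_comp mnat).
by apply: measurable_fun_ltr; [exact: measurable_cst|exact: measurable_fst].
Qed.

HB.instance Definition _ (R : realType) (M : R) :=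
  isMeasurableFun.Build _ _ _ _ (@storage_step2 R M)
    (@measurable_storage_step2 R M).

(* One step of the chain on laws: the law of [storage_step M b x] for
   independent [b] of law [mu] and [x] of law [nu]. *)
Definition next_law (R : realType) (M : R) (nu mu : probability R R) :
    probability R R :=
  distribution (mu \x nu)%E (@storage_step2 R M).

Definition law_at (R : realType) (M : R) (nu mu : probability R R) (n : nat) :
    probability R R :=
  iter n (next_law M nu) mu.

Definition on_state_space (R : realType) (mu : probability R R) : Prop :=
  mu `[0, +oo[%classic = 1%E.

Definition stationary_law (R : realType) (M : R) (nu pi : probability R R) :
    Prop :=
  on_state_space pi /\
  forall (n : nat) (A : set R), measurable A -> law_at M nu pi n A = pi A.

Definition limiting_law (R : realType) (M : R) (nu pi : probability R R) :
    Prop :=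
  stationary_law M nu pi /\
  exists mu : probability R R, on_state_space mu /\
    tv_dist (law_at M nu mu n) pi @[n --> \oo] --> (0 : R).

Definition buffer_pdf (R : realType) (M lambda p x : R) : R :=
  if x <= 0 then 0
  else if x <= M then M^-1 * (1 - expR (p * x))
  else - p / (M * (lambda + p)) * expR (p * x).

(* Main.v *)
(** The process is a Markov chain b |-> T b + x, with T b = b - M 1_{b > M} and
    x exponential of rate lambda.  By memorylessness, from every b in [0, L] the
    next state dominates e^(-lambda L) times the law of L + x, and since
    lambda M > 1 some V b = e^(s b) is contracted by the chain outside of
    [0, M].  The dual argument of Hairer and Mattingly turns these two facts
    into a one-step contraction, for a weight W = 1 + beta V, of the bounds
    |phi x - phi y| <= c (W x + W y) on [0, 1]-valued functions phi.  Hence two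
    chains with arbitrary initial laws on [0, oo[ merge in total variation, so
    that any stationary law is unique and attracts every initial law.  It
    remains to check that the explicit density g solves
    g y = \int f (y - T b) g b db, where f is the exponential density. *)

Require Import Defs.
From HB Require Import structures.
From mathcomp Require Import all_boot all_order all_algebra.
From mathcomp Require Import finmap.
From mathcomp Require Import all_classical all_reals all_analysis.
From mathcomp Require Import measurable_realfun ring lra.

Set Implicit Arguments.
Unset Strict Implicit.
Unset Printing Implicit Defensive.

Import Order.TTheory GRing.Theory Num.Theory.
Import numFieldNormedType.Exports.

Local Open Scope classical_set_scope.
Local Open Scope ring_scope.

(** * Integration against laws with a density, translations, and laws on the half-line *)

(** Null sets of Lebesgue measure are null for [nu]. The Radon-Nikodym derivative and [f] have the
    same integral over every measurable set, so they agree almost everywhere, and the change of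
    variables for the derivative carries over to [f]. *)
Lemma ge0_integral_has_pdf (R : realType) (nu : probability R R) (f : R -> R)
    (phi : R -> \bar R) : has_pdf nu f -> measurable_fun setT phi ->
  (forall x, 0 <= phi x)%E ->
  (\int[nu]_x phi x = \int[lebesgue_measure]_x (phi x * (f x)%:E))%E.
Proof.
move=> [mf f0 nuE] mphi phi0.
(* lebesgue_measure lives on measurableTypeR R, whose display differs from
   the default one of R. *)
have mid : measurable_fun [set: R] (id : R -> measurableTypeR R) by [].
pose idL : {mfun R >-> measurableTypeR R} :=
  HB.pack (id : R -> measurableTypeR R) (isMeasurableFun.Build _ _ _ _ _ mid).
pose nu' : probability (measurableTypeR R) R := distribution nu idL.
transitivity (\int[nu']_x phi x)%E; first by rewrite ge0_integral_distribution.
have nu'E (A : set (measurableTypeR R)) : measurable A ->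
  nu' A = (\int[lebesgue_measure]_(x in A) (f x)%:E)%E by exact: nuE.
have dom : nu' `<< (@lebesgue_measure R).
  apply/null_content_dominatesP => A mA A0; rewrite nu'E//.
  by rewrite null_set_integral//; exact/measurable_funTS/measurable_EFinP.
rewrite -(Radon_Nikodym_SigmaFinite.change_of_variables dom)//.
have mD := measurable_int _ (Radon_Nikodym_SigmaFinite.f_integrable dom).
apply: ae_eq_integral => //.
- exact: emeasurable_funM.
- by apply: emeasurable_funM => //; exact/measurable_EFinP.
- apply: ae_eqe_mul2l; apply: integral_ae_eq => //.
  + exact: Radon_Nikodym_SigmaFinite.f_integrable.
  + exact/measurable_EFinP.
  + move=> A _ mA; rewrite -nu'E//.
    by rewrite -Radon_Nikodym_SigmaFinite.f_integral.
Qed.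

(** The translated measure gives every half-open interval its length, which characterizes Lebesgue
    measure. *)
Lemma lebesgue_measure_shift (R : realType) (a : R) (A : set R) :
  measurable A -> lebesgue_measure ((fun x : R => x + a) @^-1` A)
                  = lebesgue_measure A :> \bar R.
Proof.
move=> mA.
have ms : measurable_fun [set: measurableTypeR R]
    ((fun x : R => x + a) : _ -> measurableTypeR R).
  by apply: measurable_funD.
pose sh : {mfun measurableTypeR R >-> measurableTypeR R} :=
  HB.pack ((fun x : R => x + a) : measurableTypeR R -> measurableTypeR R)
    (isMeasurableFun.Build _ _ _ _ _ ms).
apply/esym.
rewrite (@lebesgue_measure_unique _ (pushforward lebesgue_measure sh))//.
move=> X [[x y]] /= xy <-.
rewrite /pushforward/=.
rewrite (_ : _ @^-1` _ = `]x - a, y - a]%classic); last first.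
  by apply/seteqP; split => z /=; rewrite !in_itv/= ltrBlDr lerBrDr.
rewrite !lebesgue_measure_itv/= !lte_fin ltrD2r.
by case: ifPn => //; rewrite -!EFinD => _; congr (_%:E); lra.
Qed.

Lemma ge0_integral_shift (R : realType) (a : R) (phi : R -> \bar R) :
  measurable_fun setT phi -> (forall x, 0 <= phi x)%E ->
  (\int[lebesgue_measure]_x phi (x + a)%R = \int[lebesgue_measure]_x phi x)%E.
Proof.
move=> mphi phi0.
have ms : measurable_fun [set: measurableTypeR R]
    ((fun x : R => x + a) : _ -> measurableTypeR R).
  by apply: measurable_funD.
pose sh : {mfun measurableTypeR R >-> measurableTypeR R} :=
  HB.pack ((fun x : R => x + a) : measurableTypeR R -> measurableTypeR R)
    (isMeasurableFun.Build _ _ _ _ _ ms).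
rewrite [RHS](_ : _ = \int[pushforward lebesgue_measure sh]_x phi x)%E.
  by rewrite ge0_integral_pushforward//.
apply: eq_measure_integral => A mA _.
by rewrite /pushforward/=; apply/esym/lebesgue_measure_shift.
Qed.

(** Moving the translation onto the density lets the kernels from two starting points be compared
    pointwise, against one and the same [psi]. *)
Lemma ge0_integral_has_pdf_shift (R : realType) (nu : probability R R)
    (f psi : R -> R) (c : R) : has_pdf nu f -> measurable_fun setT psi ->
  (forall x : R, 0 <= psi x) ->
  (\int[nu]_x (psi (c + x))%:E =
   \int[lebesgue_measure]_x ((psi x)%:E * (f (x - c))%:E))%E.
Proof.
move=> nuf mpsi psi0; have [mf f0 _] := nuf.
rewrite (ge0_integral_has_pdf nuf); last 2 first.
- apply/measurable_EFinP; apply: (measurableT_comp mpsi).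
  exact: measurable_funD.
- by move=> x; rewrite lee_fin.
rewrite -[RHS](ge0_integral_shift c)//.
- by apply: eq_integral => x _; rewrite addrK addrC.
- apply/measurable_EFinP; apply: measurable_funM => //.
  by apply: (measurableT_comp mf); exact: measurable_funD.
- by move=> x; rewrite -EFinM lee_fin mulr_ge0.
Qed.

Lemma on_state_space_ae (R : realType) (mu : probability R R) (Q : R -> Prop) :
  on_state_space mu -> (forall x, 0 <= x -> Q x) -> {ae mu, forall x, Q x}.
Proof.
move=> mu0 Q0; exists (~` `[0, +oo[%classic); split.
- exact: measurableC.
- by rewrite probability_setC// mu0 subee.
- by move=> x /= nQ; rewrite in_itv/= andbT => x0; exact/nQ/Q0.
Qed.

Lemma on_state_space_eq_integral (R : realType) (mu : probability R R)
    (phi psi : R -> \bar R) : on_state_space mu ->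
  measurable_fun setT phi -> measurable_fun setT psi ->
  (forall x, 0 <= x -> phi x = psi x) ->
  (\int[mu]_x phi x = \int[mu]_x psi x)%E.
Proof.
move=> mu0 mphi mpsi E; apply: ae_eq_integral => //.
by apply: (on_state_space_ae mu0) => x x0 _; exact: E.
Qed.

(** * The exponential law: exponential moments and memorylessness *)

Section exponential_law.
Variables (R : realType) (lambda : R) (nu : probability R R).
Hypothesis lambda_gt0 : 0 < lambda.
Hypothesis nu_exp : has_pdf nu (exponential_pdf lambda).

(** Exponential tilting: $e^{sx}$ times the density of rate $\lambda$ is $\lambda/(\lambda-s)$ times
    the density of rate $\lambda-s$, which has integral $1$. *)
Lemma exponential_law_mgf (s : R) : s < lambda ->
  (\int[nu]_x (expR (s * x))%:E = (lambda / (lambda - s))%:E)%E.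
Proof.
move=> sl.
have ls : 0 < lambda - s by rewrite subr_gt0.
rewrite (ge0_integral_has_pdf nu_exp); last 2 first.
- apply/measurable_EFinP; apply: (measurableT_comp (@measurable_expR R)).
  exact: mulrl_measurable.
- by move=> x; rewrite lee_fin expR_ge0.
transitivity (\int[lebesgue_measure]_x
    ((lambda / (lambda - s))%:E * (exponential_pdf (lambda - s) x)%:E))%E.
  apply: eq_integral => x _; rewrite -!EFinM; congr (_%:E).
  have [x0|x0] := ltP x 0; first by rewrite !lt0_exponential_pdf// !mulr0.
  rewrite (exponential_pdfE lambda x0) (exponential_pdfE (lambda - s) x0).
  rewrite [RHS]mulrA divfK ?gt_eqF//.
  by rewrite mulrCA -expRD; congr (_ * expR _); ring.
rewrite ge0_integralZl//=.
- by rewrite integral_exponential_pdf// mule1.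
- by apply/measurable_EFinP; exact: measurable_exponential_pdf.
- by move=> x _; rewrite lee_fin exponential_pdf_ge0// ltW.
- by rewrite lee_fin divr_ge0// ltW.
Qed.

Lemma exponential_law_ge0 : on_state_space nu.
Proof.
have [_ _ nuE] := nu_exp; rewrite /on_state_space nuE//.
rewrite -(integral_exponential_pdf lambda_gt0) [LHS]integral_mkcond.
apply: eq_integral => x _; rewrite patchE; case: ifPn => //.
rewrite notin_setE/= in_itv/= andbT => /negP; rewrite -ltNge => x0.
by rewrite lt0_exponential_pdf.
Qed.


(* By memorylessness, the part above L of the law of t + x is a multiple of the
   law of L + x. *)
Lemma exponential_law_minor (t L : R) (phi : R -> R) : 0 <= t -> t <= L ->
  measurable_fun setT phi -> (forall x : R, 0 <= x -> 0 <= phi x) ->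
  ((expR (- lambda * L))%:E * \int[nu]_x (phi (L + x))%:E
   <= \int[nu]_x (phi (t + x))%:E)%E.
Proof.
move=> t0 tL mphi phi0.
have ms (c : R) : measurable_fun setT (fun x : R => c + x).
  by apply: measurable_funD.
(* [phi] is only known to be nonnegative on the half-line. Its absolute value is nonnegative
   everywhere and has the same integrals, because [nu] lives on $[0,\infty)$ and the shifts are
   nonnegative. *)
pose psi (x : R) : R := `|phi x|.
have mpsi : measurable_fun setT psi by exact: measurableT_comp.
have psi0 x : 0 <= psi x by exact: normr_ge0.
have pdf0 (x : R) : 0 <= exponential_pdf lambda x.
  by rewrite exponential_pdf_ge0// ltW.
have step (c : R) : 0 <= c -> (\int[nu]_x (phi (c + x))%:E =
    \int[lebesgue_measure]_x
      ((psi x)%:E * (exponential_pdf lambda (x - c))%:E))%E.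
  move=> c0.
  transitivity (\int[nu]_x (psi (c + x))%:E)%E.
    apply: on_state_space_eq_integral exponential_law_ge0 _ _ _.
    + apply/measurable_EFinP; exact: measurableT_comp.
    + apply/measurable_EFinP; exact: measurableT_comp.
    + by move=> x x0; rewrite /psi ger0_norm// phi0// addr_ge0.
  exact: ge0_integral_has_pdf_shift.
have mexp (c : R) :
    measurable_fun setT (fun x : R => exponential_pdf lambda (x - c)).
  apply: (measurableT_comp (measurable_exponential_pdf _)).
  exact: measurable_funD.
have mm (c : R) : measurable_fun setT
    (fun x : R => psi x * exponential_pdf lambda (x - c)).
  by apply: measurable_funM => //; exact: mexp.
rewrite !step//; last exact: le_trans tL.
rewrite -ge0_integralZl//; last 2 first.
- by apply/measurable_EFinP; exact: mm.
- by move=> x _; rewrite -EFinM lee_fin mulr_ge0 ?psi0 ?pdf0.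
apply: ge0_le_integral => //.
- by move=> x _; rewrite -!EFinM lee_fin !mulr_ge0 ?expR_ge0 ?psi0 ?pdf0.
- apply/measurable_EFinP; apply: measurable_funM => //; exact: mm.
- by apply/measurable_EFinP; exact: mm.
- move=> x _; rewrite -!EFinM lee_fin mulrCA ler_wpM2l//.
  (* Below [L] the left density vanishes. Above [L], $e^{-\lambda L}e^{-\lambda(x-L)}=e^{-\lambda
     x}\le e^{-\lambda(x-t)}$. *)
  have [xL|Lx] := ltP x L.
    by rewrite lt0_exponential_pdf ?subr_lt0// mulr0 pdf0.
  have xL0 : 0 <= x - L by rewrite subr_ge0.
  have xt0 : 0 <= x - t by rewrite subr_ge0 (le_trans tL).
  rewrite (exponential_pdfE lambda xL0) (exponential_pdfE lambda xt0).
  rewrite mulrCA ler_wpM2l ?(ltW lambda_gt0)// -expRD ler_expR.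
  have : 0 <= lambda * t by rewrite mulr_ge0// ltW.
  by lra.
Qed.
End exponential_law.


(** * The transition kernel acting on test functions *)

Definition unit_valued (R : realType) (phi : R -> R) : Prop :=
  measurable_fun setT phi /\ forall x : R, 0 <= phi x <= 1.

Definition shift_mean (R : realType) (nu : probability R R) (phi : R -> R)
    (t : R) : R := \int[nu]_x phi (t + x).

(** The Markov operator of the chain, dual to [next_law]: the mean of [phi] after one step from
    [b]. *)
Definition storage_op (R : realType) (M : R) (nu : probability R R)
    (phi : R -> R) (b : R) : R := shift_mean nu phi (b - uplink_power M b).

Lemma measurable_shift (R : realType) (phi : R -> R) (t : R) :
  measurable_fun setT phi -> measurable_fun setT (fun x : R => phi (t + x)).
Proof.
by move=> mphi; apply: (measurableT_comp mphi); exact: measurable_funD.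
Qed.

Lemma unit_valued_integrable (R : realType) (nu : probability R R)
    (phi : R -> R) (t : R) : unit_valued phi ->
  nu.-integrable setT (EFin \o (fun x : R => phi (t + x))).
Proof.
move=> [mphi phi01]; apply: (@le_integrable _ _ _ nu setT _ _ (cst 1%E)) => //.
- by apply/measurable_EFinP; exact: measurable_shift.
- move=> x _ /=; rewrite lee_fin normr1.
  by have /andP[p0 p1] := phi01 (t + x); rewrite ger0_norm.
- exact: finite_measure_integrable_cst.
Qed.

Lemma shift_meanE (R : realType) (nu : probability R R) (phi : R -> R) (t : R) :
  unit_valued phi ->
  (shift_mean nu phi t)%:E = (\int[nu]_x (phi (t + x))%:E)%E.
Proof.
by move=> u; rewrite fineK//; apply: integrable_fin_num => //;
  exact: unit_valued_integrable.
Qed.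

Section exponential_kernel.
Variables (R : realType) (lambda s : R) (nu : probability R R).
Hypotheses (s_gt0 : 0 < s) (s_lt : s < lambda).
Hypothesis nu_exp : has_pdf nu (exponential_pdf lambda).

Let lambda_gt0 : 0 < lambda. Proof. exact: lt_trans s_lt. Qed.

Variables (phi : R -> R) (p q r : R).
Hypothesis phi_unit : unit_valued phi.

(** The shape shared by the two gap functions of the contraction argument: $\pm\varphi$, a constant,
    and a multiple of the drift function $e^{sx}$. *)
Let test (x : R) : R := p * phi x + q + r * expR (s * x).

Lemma measurable_affine_exp : measurable_fun setT test.
Proof.
have [mphi _] := phi_unit.
apply: measurable_funD; first by apply: measurable_funD => //;
  exact: measurable_funM.
apply: measurable_funM => //.
apply: (measurableT_comp (@measurable_expR R)); exact: mulrl_measurable.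
Qed.

Let exp_integrable (t : R) :
  nu.-integrable setT (EFin \o (fun x : R => expR (s * (t + x)))).
Proof.
have -> : EFin \o (fun x : R => expR (s * (t + x))) =
    (fun x : R => (expR (s * t))%:E * (expR (s * x))%:E)%E.
  by apply/funext => x /=; rewrite mulrDr expRD EFinM.
apply: integrableZl => //; apply/integrableP; split.
  apply/measurable_EFinP; apply: (measurableT_comp (@measurable_expR R)).
  exact: mulrl_measurable.
under eq_integral do rewrite /= ger0_norm ?expR_ge0//.
by rewrite (exponential_law_mgf lambda_gt0 nu_exp)// ltry.
Qed.

Lemma shift_mean_expR (t : R) : shift_mean nu (fun x : R => expR (s * x)) t =
  lambda / (lambda - s) * expR (s * t).
Proof.
rewrite /shift_mean.
under eq_Rintegral do rewrite mulrDr expRD.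
rewrite RintegralZl//.
  by rewrite /Rintegral (exponential_law_mgf lambda_gt0 nu_exp)//= mulrC.
have := exp_integrable 0; apply: eq_integrable => // x _ /=.
by rewrite add0r.
Qed.

Let phi_integrable (t : R) :
  nu.-integrable setT (EFin \o (fun x : R => phi (t + x))).
Proof. exact: unit_valued_integrable. Qed.

Let Zphi_integrable (t : R) :
  nu.-integrable setT (EFin \o (fun x : R => p * phi (t + x))).
Proof.
by have := integrableZl measurableT p (phi_integrable t); apply: eq_integrable.
Qed.

Let Zexp_integrable (t : R) :
  nu.-integrable setT (EFin \o (fun x : R => r * expR (s * (t + x)))).
Proof.
by have := integrableZl measurableT r (exp_integrable t); apply: eq_integrable.
Qed.

Let affine_integrable (t : R) :
  nu.-integrable setT (EFin \o (fun x : R => p * phi (t + x) + q)).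
Proof.
have := integrableD measurableT (Zphi_integrable t)
  (finite_measure_integrable_cst nu q measurableT).
exact: eq_integrable.
Qed.

Lemma affine_exp_integrable (t : R) :
  nu.-integrable setT (EFin \o (fun x : R => test (t + x))).
Proof.
have := integrableD measurableT (affine_integrable t) (Zexp_integrable t).
exact: eq_integrable.
Qed.

Lemma shift_mean_affine (t : R) :
  shift_mean nu test t =
  p * shift_mean nu phi t + q + r * (lambda / (lambda - s) * expR (s * t)).
Proof.
rewrite -shift_mean_expR /shift_mean RintegralD//.
rewrite RintegralD//; last exact: finite_measure_integrable_cst.
by rewrite !RintegralZl// Rintegral_cst// [X in fine X]probability_setT mulr1.
Qed.

Hypothesis test_ge0 : forall x : R, 0 <= x -> 0 <= test x.

Lemma shift_mean_affine_ge0 (t : R) : 0 <= t -> 0 <= shift_mean nu test t.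
Proof.
move=> t0; rewrite /shift_mean /Rintegral.
have mt := measurable_shift t measurable_affine_exp.
rewrite (@on_state_space_eq_integral _ _ _
  (fun x : R => `|test (t + x)|%:E) (exponential_law_ge0 lambda_gt0 nu_exp)).
- by rewrite fine_ge0// integral_ge0// => x _; rewrite lee_fin.
- exact/measurable_EFinP.
- by apply/measurable_EFinP; exact: measurableT_comp.
- by move=> x x0; rewrite ger0_norm// test_ge0// addr_ge0.
Qed.

Lemma shift_mean_affine_minor (t L : R) : 0 <= t -> t <= L ->
  expR (- lambda * L) * shift_mean nu test L <= shift_mean nu test t.
Proof.
move=> t0 tL.
have := exponential_law_minor lambda_gt0 nu_exp t0 tL measurable_affine_exp
  test_ge0.
have fin u := integrable_fin_num measurableT (affine_exp_integrable u).
by rewrite -(fineK (fin L)) -(fineK (fin t)) -EFinM lee_fin.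
Qed.
End exponential_kernel.

(** * Drift, minorization and the weighted one-step contraction *)

Section storage_contraction.
Variables (R : realType) (M lambda : R) (nu : probability R R).
Hypotheses (M_gt0 : 0 < M) (lambda_gt0 : 0 < lambda).
Hypothesis lambdaM_gt1 : 1 < lambda * M.
Hypothesis nu_exp : has_pdf nu (exponential_pdf lambda).

(** Since $e^{sM}\ge 1+sM$, it suffices that $\lambda<(\lambda-s)(1+sM)$, that is $s(\lambda
    M-1-sM)>0$. This holds for $0<s<\lambda-1/M$, and the witness is the midpoint of that
    interval. *)
Lemma exp_drift : exists2 s : R, 0 < s < lambda &
  lambda / (lambda - s) * expR (- (s * M)) < 1.
Proof.
have iM : M * M^-1 = 1 by rewrite divff ?gt_eqF.
have iM0 : 0 < M^-1 by rewrite invr_gt0.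
have iMl : M^-1 < lambda.
  by rewrite -(ltr_pM2l M_gt0) iM mulrC.
exists ((lambda - M^-1) / 2); first by apply/andP; split; lra.
set s := _ / 2.
have s0 : 0 < s by rewrite /s; lra.
have ls : 0 < lambda - s by rewrite /s; lra.
rewrite expRN -mulrA -invfM ltr_pdivrMr ?mul1r ?mulr_gt0 ?expR_gt0//.
apply: (@lt_le_trans _ _ ((lambda - s) * (1 + s * M))); last first.
  by rewrite ler_pM2l// expR_ge1Dx.
have : 0 < s * (lambda * M - 1 - s * M).
  rewrite mulr_gt0// /s.
  have -> : (lambda - M^-1) / 2 * M = (lambda * M - M * M^-1) / 2 by ring.
  by rewrite iM; have := lambdaM_gt1; set u := lambda * M; lra.
by lra.
Qed.

(** [g] and [K] are the drift constants, [a] is the factor of the minorization, and [S] stands for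
    [V x + V y]. For large [S] the drift alone contracts; the second inequality relies on the gain
    [2 * a] from the minorization. *)
Lemma contraction_constants (g K a : R) : 0 < g < 1 -> 0 < K -> 0 < a < 1 ->
  exists beta alpha : R, [/\ 0 < beta, 0 <= alpha < 1 & forall S : R, 0 <= S ->
    (4 * K / (1 - g) <= S ->
       2 + beta * (g * S + 2 * K) <= alpha * (2 + beta * S)) /\
    (2 + beta * (g * S + 2 * K) - 2 * a <= alpha * (2 + beta * S))].
Proof.
move=> /andP[g0 g1] K0 /andP[a0 a1].
set R0 := 4 * K / (1 - g).
have R0E : R0 * (1 - g) = 4 * K by rewrite divfK// subr_eq0 gt_eqF.
have R00 : 0 < R0 by rewrite divr_gt0 ?mulr_gt0 ?subr_gt0.
(* With this choice the additive drift term [b * (2 * K)] costs only [a], half of the gain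
   [2 * a]. *)
pose b := a / (2 * K); have bE : b * (2 * K) = a.
  by rewrite divfK// mulf_neq0 ?gt_eqF.
have b0 : 0 < b by rewrite divr_gt0 ?mulr_gt0.
(* For [R0 <= S] one has $2K\le\frac{1-g}{2}S$, so the drift has rate at most [gh < 1]. The quotient
   [(2 + b * gh * S) / (2 + b * S)] decreases in [S], and [alpha1] is its value at [R0]. *)
pose gh := (1 + g) / 2.
pose alpha1 := (2 + b * gh * R0) / (2 + b * R0).
have bR0 : 0 < b * R0 by rewrite mulr_gt0.
have a1E : alpha1 * (2 + b * R0) = 2 + b * gh * R0.
  by rewrite divfK// gt_eqF// addr_gt0.
have alpha1_lt1 : alpha1 < 1.
  rewrite ltr_pdivrMr ?addr_gt0// mul1r ltrD2l.
  by rewrite mulrAC -subr_gt0 -{1}[b * R0]mulr1 -mulrBr mulr_gt0// /gh; lra.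
exists b, (Num.max alpha1 (Num.max (1 - a / 2) g)); split => //.
  rewrite !le_max !gt_max alpha1_lt1 g1 (ltW g0) !orbT /= andbT.
  lra.
move=> S S0; have bS : 0 <= b * S by rewrite mulr_ge0// ltW.
split=> [RS|].
- apply: (@le_trans _ _ (alpha1 * (2 + b * S))); last first.
    by rewrite ler_wpM2r ?addr_ge0// le_max lexx.
  apply: (@le_trans _ _ (2 + b * gh * S)).
    rewrite lerD2l -mulrA ler_pM2l//.
    have : R0 * (1 - g) <= S * (1 - g) by rewrite ler_wpM2r// subr_ge0 ltW.
    by rewrite R0E /gh; lra.
  rewrite -(ler_pM2r (_ : 0 < 2 + b * R0)) ?addr_gt0//.
  rewrite [leRHS]mulrAC a1E -subr_ge0.
  have -> : (2 + b * gh * R0) * (2 + b * S) - (2 + b * gh * S) * (2 + b * R0)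
     = 2 * (b * (1 - gh) * (S - R0)) by ring.
  by rewrite mulr_ge0// mulr_ge0 ?subr_ge0// mulr_ge0 ?ltW// /gh; lra.
- set al := Num.max _ _.
  have al1 : 1 - a / 2 <= al by rewrite /al !le_max lexx ?orbT.
  have al2 : g <= al by rewrite /al !le_max lexx ?orbT.
  have : g * (b * S) <= al * (b * S) by rewrite ler_wpM2r.
  by rewrite [b * (_ + _)]mulrDr bE; lra.
Qed.

(** After centring [phi] at a constant [k], the functions $cW\pm(\varphi-k)$ are nonnegative on the
    half-line. Positivity of the kernel, sharpened by the minorization near the origin, bounds the
    difference of the two means. *)
Lemma storage_op_contraction : exists (W : R -> R) (alpha : R),
  [/\ measurable_fun setT W, 0 <= alpha < 1, forall x : R, 1 <= W x &
   forall (phi : R -> R) (c : R), unit_valued phi -> 0 <= c ->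
    (forall x y : R, 0 <= x -> 0 <= y ->
       `|phi x - phi y| <= c * (W x + W y)) ->
    forall x y : R, 0 <= x -> 0 <= y ->
      `|storage_op M nu phi x - storage_op M nu phi y|
      <= alpha * c * (W x + W y)].
Proof.
have [s /andP[s0 sl] gs1] := exp_drift.
set rho := lambda / (lambda - s).
have rho0 : 0 < rho by rewrite divr_gt0// subr_gt0.
set g := rho * expR (- (s * M)) in gs1.
have g01 : 0 < g < 1 by rewrite gs1 andbT mulr_gt0// expR_gt0.
(* On [[0, M]] nothing is transmitted, and [K] bounds the mean of $e^{sb}$ after one step from
   there. *)
pose K := rho * expR (s * M).
have K0 : 0 < K by rewrite mulr_gt0// expR_gt0.
(* [R0] is the threshold of [contraction_constants]. By $1+sx\le e^{sx}$, [V x <= R0] forces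
   [x <= L], so the minorization up to [L] covers the case of small [V x + V y]. *)
pose R0 := 4 * K / (1 - g).
have R00 : 0 < R0.
  have /andP[_ g1] := g01; apply: divr_gt0; first exact: mulr_gt0.
  by rewrite subr_gt0.
pose L := R0 / s.
have L0 : 0 < L by rewrite divr_gt0.
pose a := expR (- lambda * L).
have a01 : 0 < a < 1.
  by rewrite expR_gt0 expR_lt1 mulNr oppr_lt0 mulr_gt0.
have [beta [alpha [beta0 alpha01 cst]]] := contraction_constants g01 K0 a01.
pose V (x : R) := expR (s * x).
pose W (x : R) := 1 + beta * V x.
exists W, alpha; split => //.
- apply: measurable_funD => //; apply: measurable_funM => //.
  apply: (measurableT_comp (@measurable_expR R)); exact: mulrl_measurable.
- by move=> x; rewrite lerDl mulr_ge0 ?expR_ge0// ltW.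
move=> phi c phi_unit c0 phi_lip.
pose T (x : R) := x - uplink_power M x.
have T_ge0 (x : R) : 0 <= x -> 0 <= T x.
  rewrite /T /uplink_power => x0; case: (ltP M x) => Mx.
    by rewrite mulr1 subr_ge0 ltW.
  by rewrite mulr0 subr0.
have T_le (x : R) : T x <= x.
  by rewrite /T lerBlDr lerDl /uplink_power mulr_ge0// ltW.
have drift (x : R) : rho * V (T x) <= g * V x + K.
  rewrite /T /uplink_power /g /K /V; case: (ltP M x) => Mx.
    rewrite mulr1 mulrBr expRD [expR (s * x) * _]mulrC mulrA lerDl.
    by rewrite mulr_ge0 ?expR_ge0// ltW.
  rewrite mulr0 subr0; apply: (@le_trans _ _ (rho * expR (s * M))).
    by rewrite ler_pM2l// ler_expR ler_pM2l.
  by rewrite lerDr mulr_ge0 ?expR_ge0// mulr_ge0 ?expR_ge0// ltW.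
have small (x : R) : V x <= R0 -> x <= L.
  move=> xR0; rewrite ler_pdivlMr// mulrC (le_trans _ xR0)//.
  by rewrite (le_trans _ (expR_ge1Dx _))// lerDr.
(* The two bounds say that |phi - k| <= c W. *)
have [k [k_ge k_le]] : exists k : R,
    (forall x : R, 0 <= x -> phi x - c * W x <= k) /\
    (forall x : R, 0 <= x -> k <= phi x + c * W x).
  (* By [phi_lip] the intervals $[\varphi(x)-cW(x),\varphi(x)+cW(x)]$ meet pairwise, so the supremum
     of their left endpoints lies in all of them. *)
  pose A := [set u | exists2 x : R, 0 <= x & u = phi x - c * W x].
  have ubA (y : R) : 0 <= y -> ubound A (phi y + c * W y).
    move=> y0 _ [x x0 ->]; rewrite lerBlDr -addrA -mulrDr [W y + _]addrC.
    by rewrite -lerBlDl; exact: le_trans (ler_norm _) (phi_lip _ _ x0 y0).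
  have A0 : A !=set0 by exists (phi 0 - c * W 0), 0.
  exists (sup A); split => [x x0|x x0].
    apply: ub_le_sup; last by exists x.
    by exists (phi 0 + c * W 0); exact: ubA.
  by apply: ge_sup => //; exact: ubA.
(* [u1] is $cW+(\varphi-k)$ and [u2] is $cW-(\varphi-k)$. The mean of [u2] from [T x] plus that of
   [u1] from [T y] contains $-(e_x-e_y)$, so lower bounds on these means bound [ex - ey] from
   above. *)
pose u1 (x : R) : R := 1 * phi x + (c - k) + c * beta * V x.
pose u2 (x : R) : R := -1 * phi x + (k + c) + c * beta * V x.
have u1_ge0 (x : R) : 0 <= x -> 0 <= u1 x.
  by move=> /k_le; rewrite /u1 /W; lra.
have u2_ge0 (x : R) : 0 <= x -> 0 <= u2 x.
  by move=> /k_ge; rewrite /u2 /W; lra.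
have one (x y : R) : 0 <= x -> 0 <= y ->
    shift_mean nu phi (T x) - shift_mean nu phi (T y)
    <= alpha * c * (W x + W y).
  move=> x0 y0.
  set ex := shift_mean nu phi (T x); set ey := shift_mean nu phi (T y).
  pose S := V x + V y.
  have S0 : 0 <= S by rewrite addr_ge0 ?expR_ge0.
  have [cst1 cst2] := cst S S0.
  have cbeta0 : 0 <= c * beta by rewrite mulr_ge0// ltW.
  have drifts : c * beta * (rho * V (T x)) + c * beta * (rho * V (T y))
      <= c * (beta * (g * S + 2 * K)).
    rewrite -mulrDr mulrA ler_wpM2l// /S.
    by have := drift x; have := drift y; lra.
  suff : ex - ey <= c * (alpha * (2 + beta * S)) by rewrite /W /S; lra.
  have [RS|SR] := leP R0 S.
    have := ler_wpM2l c0 (cst1 RS).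
    have := shift_mean_affine_ge0 s0 sl nu_exp phi_unit u2_ge0 (T_ge0 _ x0).
    have := shift_mean_affine_ge0 s0 sl nu_exp phi_unit u1_ge0 (T_ge0 _ y0).
    rewrite !(shift_mean_affine s0 sl nu_exp _ _ _ phi_unit) -/rho -/ex -/ey.
    rewrite -!/(V _).
    by move: drifts; lra.
  (* In the near case both means dominate [a] times the means from [L]. There the $\varphi$ terms
     cancel, since [u1 + u2] is $2cW\ge 2c$, which leaves the gain $2ac$. *)
  have Tx_L : T x <= L.
    apply: le_trans (T_le _) (small _ _); apply: le_trans (ltW SR).
    by rewrite lerDl expR_ge0.
  have Ty_L : T y <= L.
    apply: le_trans (T_le _) (small _ _); apply: le_trans (ltW SR).
    by rewrite lerDr expR_ge0.
  have := ler_wpM2l c0 cst2.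
  have := shift_mean_affine_minor s0 sl nu_exp phi_unit u2_ge0
    (T_ge0 _ x0) Tx_L.
  have := shift_mean_affine_minor s0 sl nu_exp phi_unit u1_ge0
    (T_ge0 _ y0) Ty_L.
  rewrite !(shift_mean_affine s0 sl nu_exp _ _ _ phi_unit) -/rho -/ex -/ey -/a.
  rewrite -!/(V _).
  have : 0 <= a * (c * beta * (rho * V L)).
    have /andP[/ltW a0 _] := a01.
    apply: mulr_ge0 => //; apply: mulr_ge0 => //.
    by rewrite mulr_ge0 ?expR_ge0// ltW.
  by move: drifts; lra.
move=> x y x0 y0; rewrite ler_norml; apply/andP; split; last exact: one.
by rewrite lerNl opprB [W x + W y]addrC; exact: one.
Qed.
End storage_contraction.


(** * Duality between iterated laws and iterated test functions *)

Section law_iteration.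
Variables (R : realType) (M : R) (nu : probability R R).

Lemma ge0_integral_next_law (mu : probability R R) (phi : R -> \bar R) :
  measurable_fun setT phi -> (forall x : R, 0 <= phi x)%E ->
  (\int[next_law M nu mu]_x phi x =
   \int[mu]_b \int[nu]_x phi (storage_step M b x))%E.
Proof.
move=> mphi phi0; rewrite ge0_integral_distribution//.
rewrite (fubini_tonelli1 (phi \o (@storage_step2 R M)))//.
  by apply: measurableT_comp => //; exact: measurable_storage_step2.
by move=> z /=.
Qed.

Lemma unit_valued_storage_op (phi : R -> R) :
  unit_valued phi -> unit_valued (storage_op M nu phi).
Proof.
move=> uphi; have [mphi phi01] := uphi; split.
  apply/measurable_EFinP.
  rewrite (_ : EFin \o _ = fubini_F nu
      (EFin \o phi \o (@storage_step2 R M))); last first.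
    by apply/funext => b; rewrite /= shift_meanE.
  apply: measurable_fun_fubini_tonelli_F.
  - apply: measurableT_comp; last exact: measurable_storage_step2.
    exact/measurable_EFinP.
  - by move=> z /=; rewrite lee_fin; have /andP[] := phi01 (storage_step2 M z).
have phi0 (x : R) : 0 <= phi x by have /andP[] := phi01 x.
have phi1 (x : R) : phi x <= 1 by have /andP[] := phi01 x.
move=> b; rewrite -!lee_fin shift_meanE//; apply/andP; split.
  by apply: integral_ge0 => x _; rewrite lee_fin phi0.
apply: (@le_trans _ _ (\int[nu]_x cst 1 x)%E); last first.
  by rewrite integral_cst// mul1e; exact: probability_le1.
apply: ge0_le_integral => //.
- by move=> x _; rewrite lee_fin phi0.
- by apply/measurable_EFinP; exact: measurable_shift.
- by move=> x _; rewrite lee_fin phi1.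
Qed.

Lemma unit_valued_iter (phi : R -> R) (n : nat) :
  unit_valued phi -> unit_valued (iter n (storage_op M nu) phi).
Proof.
by move=> u; elim: n => // n IH; exact: unit_valued_storage_op.
Qed.

(** Each step of the chain moves from the law to the test function, so that contraction on functions
    controls laws. The induction peels off the last step and therefore generalizes over [phi]. *)
Lemma integral_law_at (mu : probability R R) (n : nat) (phi : R -> R) :
  unit_valued phi ->
  (\int[law_at M nu mu n]_x (phi x)%:E =
   \int[mu]_x (iter n (storage_op M nu) phi x)%:E)%E.
Proof.
elim: n phi => // n IH phi uphi.
have [mphi phi01] := uphi.
rewrite iterSr -IH; last exact: unit_valued_storage_op.
rewrite [LHS]ge0_integral_next_law.
- by apply: eq_integral => b _; rewrite shift_meanE.
- exact/measurable_EFinP.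
- by move=> x; rewrite lee_fin; have /andP[] := phi01 x.
Qed.

Lemma unit_valued_indic (A : set R) : measurable A ->
  unit_valued (\1_A : R -> R).
Proof.
move=> mA; split; first exact: measurable_indic.
by move=> x; rewrite indicE; case: (_ \in _); rewrite /= ?lexx ?ler01.
Qed.

Lemma law_atE (mu : probability R R) (n : nat) (A : set R) : measurable A ->
  (law_at M nu mu n A =
   \int[mu]_x (iter n (storage_op M nu) (\1_A : R -> R) x)%:E)%E.
Proof.
move=> mA; rewrite -integral_law_at; last exact: unit_valued_indic.
by rewrite integral_indic// setIT.
Qed.

End law_iteration.

(** * Total variation distance *)

Section tv_dist_lemmas.
Variables (R : realType).
Implicit Types mu nu pi : probability R R.

(** Boundedness makes the [sup] in [tv_dist] a genuine least upper bound rather than a default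
    value. *)
Let event_ubound mu nu : has_ubound [set r | exists A : set R,
  measurable A /\ r = `|fine (mu A) - fine (nu A)|].
Proof.
exists 1 => r [A [mA ->]].
have fin (m : probability R R) : 0 <= fine (m A) <= 1.
  have mAfin : m A \is a fin_num by exact: fin_num_measure.
  by rewrite fine_ge0//= -lee_fin fineK// probability_le1.
have /andP[? ?] := fin mu; have /andP[? ?] := fin nu.
by rewrite ler_norml; apply/andP; split; lra.
Qed.

Lemma tv_dist_ge mu nu (A : set R) : measurable A ->
  `|fine (mu A) - fine (nu A)| <= tv_dist mu nu.
Proof. by move=> mA; apply: ub_le_sup; [exact: event_ubound|exists A]. Qed.

Lemma tv_dist_ge0 mu nu : 0 <= tv_dist mu nu.
Proof. exact: le_trans (normr_ge0 _) (tv_dist_ge _ _ measurableT). Qed.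

Lemma tv_dist_le mu nu (e : R) :
  (forall A : set R, measurable A -> `|fine (mu A) - fine (nu A)| <= e) ->
  tv_dist mu nu <= e.
Proof.
move=> he; apply: ge_sup; last by move=> r [A [mA ->]]; exact: he.
by exists `|fine (mu set0) - fine (nu set0)|, set0.
Qed.

Lemma eq_tv_distl mu mu' nu :
  (forall A : set R, measurable A -> mu A = mu' A) ->
  tv_dist mu nu = tv_dist mu' nu.
Proof.
move=> E; congr sup; apply/seteqP; split => r /= [A [mA ->]]; exists A;
  by rewrite E.
Qed.

End tv_dist_lemmas.

(** * Loss of memory, convergence and uniqueness of the stationary law *)

Section storage_convergence.
Variables (R : realType) (M lambda : R) (nu : probability R R).
Hypotheses (M_gt0 : 0 < M) (lambda_gt0 : 0 < lambda).
Hypothesis lambdaM_gt1 : 1 < lambda * M.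
Hypothesis nu_exp : has_pdf nu (exponential_pdf lambda).

(** Iterating the contraction from $|\varphi(x)-\varphi(y)|\le 1\le W(x)+W(y)$ gives the bound
    $\alpha^n(W(x)+W(y))$, uniformly over events. The sequence [e] depends on the two initial laws
    but not on [A]. *)
Lemma storage_loss_of_memory (mu pi : probability R R) :
  on_state_space mu -> on_state_space pi ->
  exists e : nat -> R, e n @[n --> \oo] --> (0 : R) /\
    forall (n : nat) (A : set R), measurable A ->
      `|fine (law_at M nu mu n A) - fine (law_at M nu pi n A)| <= e n.
Proof.
move=> mu0 pi0.
have [W [alpha [mW /andP[al0 al1] W1 contr]]] :=
  storage_op_contraction M_gt0 lambda_gt0 lambdaM_gt1 nu_exp.
have W0 x : 0 <= W x by exact: le_trans ler01 (W1 x).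
have iter_lip (phi : R -> R) (n : nat) : unit_valued phi ->
    forall x y : R, 0 <= x -> 0 <= y ->
    `|iter n (storage_op M nu) phi x - iter n (storage_op M nu) phi y|
    <= alpha ^+ n * (W x + W y).
  move=> uphi; elim: n => [|n IH] x y x0 y0 /=.
    have [_ phi01] := uphi; rewrite expr0 mul1r.
    have := W1 x; have := W1 y; have /andP[? ?] := phi01 x.
    have /andP[? ?] := phi01 y => ? ?.
    by rewrite ler_norml; apply/andP; split; lra.
  rewrite exprS; apply: contr => //; first exact: unit_valued_iter.
  exact: exprn_ge0.
(* An arbitrary initial law may not integrate [W]. Truncation at $1$ allows dominated convergence
   instead, at the price of an explicit rate. *)
pose h (n : nat) (x : R) : R := Num.min 1 (alpha ^+ n * (W x + W 0)).
have mh (n : nat) : measurable_fun setT (h n).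
  by apply: measurable_minr => //; apply: measurable_funM => //;
    exact: measurable_funD.
have h01 (n : nat) x : 0 <= h n x <= 1.
  rewrite /h le_min ler01 /= ge_min lexx /= andbT.
  by rewrite mulr_ge0 ?exprn_ge0// addr_ge0.
have uh (n : nat) : unit_valued (h n) by [].
have h_int (m : probability R R) (n : nat) :
    m.-integrable setT (EFin \o h n).
  have := unit_valued_integrable m 0 (uh n); apply: eq_integrable => // x _ /=.
  by rewrite add0r.
have h_cvg (x : R) : h n x @[n --> \oo] --> (0 : R).
  have c0 : alpha ^+ n * (W x + W 0) @[n --> \oo] --> (0 : R).
    rewrite -[X in _ --> X](mul0r (W x + W 0)); apply: cvgMl.
    by apply: cvg_expr; rewrite ger0_norm.
  apply: (squeeze_cvgr _ (cvg_cst 0) c0).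
  apply: nearW => n; have /andP[-> _] /= := h01 n x.
  by rewrite /h ge_min lexx orbT.
have Eh_cvg (m : probability R R) :
    \int[m]_x h n x @[n --> \oo] --> (0 : R).
  have [|||||_ _] := @dominated_convergence _ _ _ m setT measurableT
    (fun n => EFin \o h n) (cst 0%E) (cst 1%E).
  - by move=> n; exact/measurable_EFinP.
  - exact: measurable_cst.
  - by apply: aeW => x _; apply: cvg_EFin; [exact: nearW|exact: h_cvg].
  - exact: finite_measure_integrable_cst.
  - apply: aeW => x n _ /=; have /andP[? ?] := h01 n x.
    by rewrite lee_fin ger0_norm.
  move=> lim; apply: fine_cvg; move: lim.
  by rewrite integral_cst// mul0e.
exists (fun n => \int[mu]_x h n x + \int[pi]_x h n x); split.
  by rewrite -[X in _ --> X]addr0; exact: cvgD.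
move=> n A mA; rewrite !law_atE//.
set psi := iter n _ _.
have upsi : unit_valued psi by exact/unit_valued_iter/unit_valued_indic.
have psi_int (m : probability R R) : m.-integrable setT (EFin \o psi).
  have := unit_valued_integrable m 0 upsi; apply: eq_integrable => // x _ /=.
  by rewrite add0r.
(* Both laws are compared with the chain started from the point $0$; the triangle inequality then
   combines the two deviations. *)
have dev (m : probability R R) : on_state_space m ->
    `|\int[m]_x psi x - psi 0| <= \int[m]_x h n x.
  move=> m0.
  have psi0_int : m.-integrable setT (EFin \o cst (psi 0)).
    exact: finite_measure_integrable_cst.
  have dpsi_int : m.-integrable setT (EFin \o (fun x : R => psi x - psi 0)).
    have := integrableB measurableT (psi_int m) psi0_int.
    exact: eq_integrable.
  rewrite -[X in _ - X]mulr1 -[X in _ * X]/(fine 1%E) -(probability_setT m).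
  rewrite -Rintegral_cst// -RintegralB//.
  apply: le_trans (le_normr_Rintegral _ dpsi_int) _ => //.
  have mpsi : measurable_fun setT (fun x : R => `|psi x - psi 0|).
    have [mpsi _] := upsi.
    by apply: measurableT_comp => //; exact: measurable_funB.
  apply: fine_le.
  - apply: integrable_fin_num => //; exact: integrable_abse dpsi_int.
  - exact: (integrable_fin_num measurableT (h_int m n)).
  - apply: ae_ge0_le_integral => //.
    + exact/measurable_EFinP.
    + by move=> x _; rewrite lee_fin; have /andP[] := h01 n x.
    + exact/measurable_EFinP.
    + apply: (on_state_space_ae m0) => x x0 _; rewrite lee_fin /h le_min.
      rewrite iter_lip// ?andbT; last exact: unit_valued_indic.
      have [_ psi01] := upsi.
      have /andP[? ?] := psi01 x; have /andP[? ?] := psi01 0.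
      by rewrite ler_norml; apply/andP; split; lra.
  - exact: psi_int.
rewrite -[fine _]/(\int[mu]_x psi x) -[X in _ - X]/(\int[pi]_x psi x).
rewrite -(subrKA (psi 0)) (le_trans (ler_normD _ _))// lerD ?dev//.
by rewrite distrC dev.
Qed.

Lemma storage_tv_cvg (mu pi : probability R R) :
  on_state_space mu -> stationary_law M nu pi ->
  tv_dist (law_at M nu mu n) pi @[n --> \oo] --> (0 : R).
Proof.
move=> mu0 [pi0 pi_stat].
have [e [e0 he]] := storage_loss_of_memory mu0 pi0.
apply: (squeeze_cvgr _ (cvg_cst 0) e0).
apply: nearW => n; rewrite tv_dist_ge0 /=.
apply: tv_dist_le => A mA; rewrite -(pi_stat n)//; exact: he.
Qed.

(** Started from [pi] the chain keeps the law [pi], so the constant sequence [tv_dist pi pi'] tends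
    to $0$. *)
Lemma stationary_law_unique (pi pi' : probability R R) :
  stationary_law M nu pi -> stationary_law M nu pi' ->
  forall A : set R, measurable A -> pi A = pi' A.
Proof.
move=> spi spi' A mA.
have [pi0 pi_stat] := spi.
have tv0 : tv_dist pi pi' = 0.
  have := storage_tv_cvg pi0 spi'.
  rewrite (_ : (fun n => _) = cst (tv_dist pi pi')).
    by move=> lim0; exact: cvg_unique (cvg_cst _) lim0.
  by apply/funext => n /=; apply: eq_tv_distl => B mB; exact: pi_stat.
have := tv_dist_ge pi pi' mA; rewrite tv0 normr_le0 subr_eq0 => /eqP piE.
by rewrite -[LHS]fineK ?fin_num_measure// piE fineK// fin_num_measure.
Qed.
End storage_convergence.


(** * Laws built from densities, and integrals of exponential polynomials *)

Lemma ex_probability_has_pdf (R : realType) (f : R -> R) :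
  measurable_fun setT f -> (forall x : R, 0 <= f x) ->
  (\int[lebesgue_measure]_x (f x)%:E = 1)%E ->
  exists pi : probability R R, has_pdf pi f.
Proof.
move=> mf f0 f1.
pose m (A : set R) : \bar R := (\int[lebesgue_measure]_(x in A) (f x)%:E)%E.
have m0 : m set0 = 0%E by rewrite /m integral_set0.
have m_ge0 A : (0 <= m A)%E by apply: integral_ge0 => x _; rewrite lee_fin.
have m_add : semi_sigma_additive m.
  move=> F mF tF mUF; rewrite /m; apply: cvg_toP.
    apply: ereal_nondecreasing_is_cvgn => i j ij.
    by apply: lee_sum_nneg_natr => // k _ _; exact: m_ge0.
  rewrite ge0_integral_bigcup//=.
  - by apply/measurable_EFinP; exact: measurable_funTS.
  - by move=> x _; rewrite lee_fin.
have m1 : m setT = 1%E by [].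
pose mm : {measure set R -> \bar R} :=
  HB.pack m (isMeasure.Build _ R _ m m0 m_ge0 m_add).
pose mp : probability R R :=
  HB.pack m mm (Measure_isProbability.Build _ _ _ mm m1).
by exists mp.
Qed.

Lemma is_derive_exp2 (R : realType) (c a k b l x : R) :
  is_derive x 1 (fun x : R => c * x + a * expR (k * x) + b * expR (l * x))
    (c + k * a * expR (k * x) + l * b * expR (l * x)).
Proof.
apply: is_derive_eq.
rewrite /GRing.scale/=; ring.
Qed.

Lemma continuous_exp2 (R : realType) (c a k b l : R) :
  continuous (fun x : R => c + a * expR (k * x) + b * expR (l * x)).
Proof.
have cexp (r : R) : continuous (fun x : R => expR (r * x)).
  by move=> x; apply: continuous_comp; [exact: mulrl_continuous|
    exact: continuous_expR].
move=> x; apply: cvgD; first apply: cvgD; first exact: cvg_cst.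
  by apply: cvgMr; exact: cexp.
by apply: cvgMr; exact: cexp.
Qed.

(** The coefficients [k * a] and [l * b] are those of the derivative, so the antiderivative involves
    no division and a zero rate is allowed. *)
Lemma integral_exp2 (R : realType) (c a k b l u v : R) : u <= v ->
  (\int[lebesgue_measure]_(x in `]u, v])
    (c + k * a * expR (k * x) + l * b * expR (l * x))%:E =
  (c * v + a * expR (k * v) + b * expR (l * v)
   - (c * u + a * expR (k * u) + b * expR (l * u)))%:E)%E.
Proof.
rewrite le_eqVlt => /predU1P[<-|uv].
  by rewrite set_itvoc0// integral_set0 subrr.
have cf := @continuous_exp2 R c (k * a) k (l * b) l.
rewrite integral_itv_obnd_cbnd; last first.
  apply/measurable_EFinP; apply: measurable_funTS.
  exact: continuous_measurable_fun.
rewrite EFinB.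
apply: (@continuous_FTC2 _ _
  (fun x : R => c * x + a * expR (k * x) + b * expR (l * x))) => //.
- exact: continuous_subspaceT.
- have dF (x : R) := is_derive_exp2 c a k b l x.
  have cF (x : R) : {for x, continuous
      (fun x : R => c * x + a * expR (k * x) + b * expR (l * x))}.
    apply: differentiable_continuous.
    by apply/derivable1_diffP; have [] := dF x.
  split.
  + by move=> x _; have [] := dF x.
  + by apply: cvg_at_right_filter; exact: cF.
  + by apply: cvg_at_left_filter; exact: cF.
- by move=> x _; rewrite derive1E; have [_ ->] := is_derive_exp2 c a k b l x.
Qed.

Lemma integral_exp_tail (R : realType) (q u : R) : 0 < q ->
  (\int[lebesgue_measure]_(x in `]u, +oo[) (q * expR (- q * x))%:E =
   (expR (- q * u))%:E)%E.
Proof.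
move=> q0.
have cf : continuous (fun x : R => q * expR (- q * x)).
  move=> x; have := @continuous_exp2 R 0 q (- q) 0 0 x.
  by under eq_fun do rewrite add0r mul0r addr0.
have dF (x : R) : is_derive x 1 (fun x : R => - expR (- q * x))
    (q * expR (- q * x)).
  by apply: is_derive_eq; rewrite /GRing.scale/=; ring.
rewrite integral_itv_obnd_cbnd; last first.
  apply/measurable_EFinP; apply: measurable_funTS.
  exact: continuous_measurable_fun.
rewrite (@ge0_continuous_FTC2y _ _ (fun x => - expR (- q * x)) _ 0).
- by rewrite sub0e -EFinN opprK.
- by move=> x _; rewrite mulr_ge0 ?expR_ge0// ltW.
- exact: continuous_subspaceT.
- rewrite -oppr0; apply: cvgN.
  rewrite (_ : (fun x => expR (- q * x)) =
               (fun z => expR (- z)) \o (fun z => q * z)); last first.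
    by apply: eq_fun => x; rewrite mulNr.
  apply: (@cvg_comp _ _ _ _ _ _ (pinfty_nbhs R)); last exact: cvgr_expR.
  exact: gt0_cvgMry.
- by move=> x _; have [] := dF x.
- have cF : {for u, continuous (fun x : R => - expR (- q * x))}.
    apply: differentiable_continuous.
    by apply/derivable1_diffP; have [] := dF u.
  by apply: cvg_at_right_filter; exact: cF.
- by move=> x _; rewrite derive1E; have [_ ->] := dF x.
Qed.

Lemma ge0_integral_two_pieces (R : realType) (D1 D2 : set R)
    (k k1 k2 : R -> R) : measurable D1 -> measurable D2 ->
  measurable_fun setT k1 -> measurable_fun setT k2 ->
  (forall x : R, D1 x -> 0 <= k1 x) -> (forall x : R, D2 x -> 0 <= k2 x) ->
  (forall x : R, k x = (k1 \_ D1) x + (k2 \_ D2) x) ->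
  (\int[lebesgue_measure]_x (k x)%:E =
   \int[lebesgue_measure]_(x in D1) (k1 x)%:E +
   \int[lebesgue_measure]_(x in D2) (k2 x)%:E)%E.
Proof.
move=> mD1 mD2 mk1 mk2 k10 k20 kE.
under eq_integral do rewrite kE EFinD.
rewrite ge0_integralD//.
- rewrite [in RHS]integral_mkcond [X in (_ + X)%E = _]/=.
  rewrite [X in (_ = _ + X)%E]integral_mkcond.
  by congr (_ + _)%E; apply: eq_integral => x _; rewrite !patchE; case: ifP.
- by move=> x _; rewrite lee_fin patchE; case: ifPn => // /set_mem; exact: k10.
- apply/measurable_EFinP/(measurable_restrictT _ mD1).
  exact: measurable_funTS.
- by move=> x _; rewrite lee_fin patchE; case: ifPn => // /set_mem; exact: k20.
- apply/measurable_EFinP/(measurable_restrictT _ mD2).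
  exact: measurable_funTS.
Qed.


(** * The explicit density: total mass, tail mass and the stationarity equation *)

Section stationary_density.
Variables (R : realType) (M lambda p : R).
Hypotheses (M_gt0 : 0 < M) (lambda_gt0 : 0 < lambda) (p_lt0 : p < 0).
Hypothesis pE : lambda * expR (p * M) = lambda + p.

Let g := buffer_pdf M lambda p.
Let C := - p / (M * (lambda + p)).

Let lambdap_gt0 : 0 < lambda + p.
Proof. by rewrite -pE mulr_gt0// expR_gt0. Qed.

Let expR_pM : expR (p * M) = (lambda + p) / lambda.
Proof. by rewrite -pE mulrAC divff ?mul1r// gt_eqF. Qed.

Let C_ge0 : 0 <= C.
Proof. by rewrite divr_ge0 ?oppr_ge0 ?mulr_ge0// ltW. Qed.

Let body (x : R) : R := M^-1 * (1 - expR (p * x)).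
Let tail (x : R) : R := C * expR (p * x).

Let body_ge0 (x : R) : 0 <= x -> 0 <= body x.
Proof.
move=> x0; rewrite mulr_ge0 ?invr_ge0 ?(ltW M_gt0)// subr_ge0 expR_le1.
by rewrite mulr_le0_ge0// ltW.
Qed.

Let tail_ge0 (x : R) : 0 <= tail x.
Proof. by rewrite mulr_ge0// expR_ge0. Qed.

Lemma buffer_pdfE (x : R) :
  g x = (body \_ `]0, M]) x + (tail \_ `]M, +oo[) x.
Proof.
rewrite /g /buffer_pdf !patchE !mem_setE !in_itv/= andbT.
case: (leP x 0) => x0 /=.
  by rewrite ltNge (le_trans x0) ?ltW//= addr0.
by case: (leP x M) => xM; rewrite ?addr0 ?add0r.
Qed.

Let measurable_expM (k : R) : measurable_fun setT (fun x : R => expR (k * x)).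
Proof.
apply: (measurableT_comp (@measurable_expR R)); exact: mulrl_measurable.
Qed.

Let measurable_body : measurable_fun setT body.
Proof. by apply: measurable_funM => //; exact: measurable_funB. Qed.

Let measurable_tail : measurable_fun setT tail.
Proof. by apply: measurable_funM. Qed.

Lemma measurable_buffer_pdf : measurable_fun setT g.
Proof.
rewrite (_ : g = (body \_ `]0, M]) \+ (tail \_ `]M, +oo[)); last first.
  by apply/funext => x; exact: buffer_pdfE.
apply: measurable_funD.
- apply/(measurable_restrictT _ (measurable_itv _)).
  by apply: measurable_funTS; exact: measurable_body.
- apply/(measurable_restrictT _ (measurable_itv _)).
  by apply: measurable_funTS; exact: measurable_tail.
Qed.

Lemma buffer_pdf_ge0 (x : R) : 0 <= g x.
Proof.
rewrite /g /buffer_pdf; case: (leP x 0) => // x0; case: (leP x M) => _.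
- exact: body_ge0 (ltW x0).
- exact: tail_ge0.
Qed.

(** The tail is $1/(M(\lambda+p))$ times the exponential density of rate $-p$, so its mass is
    $e^{pM}/(M(\lambda+p))$, and [pE] turns this into $1/(\lambda M)$. *)
Lemma integral_buffer_pdf_tail :
  (\int[lebesgue_measure]_(x in `]M, +oo[) (g x)%:E =
   (1 / (lambda * M))%:E)%E.
Proof.
transitivity (\int[lebesgue_measure]_(x in `]M, +oo[)
    ((M * (lambda + p))^-1%:E * (- p * expR (- (- p) * x))%:E))%E.
  apply: eq_integral => x; rewrite inE/= in_itv/= andbT => Mx.
  rewrite buffer_pdfE !patchE !mem_setE !in_itv/= andbT Mx leNgt Mx andbF add0r.
  by rewrite -EFinM /tail /C opprK; congr (_%:E); ring.
rewrite ge0_integralZl//=.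
- rewrite integral_exp_tail ?oppr_gt0// -EFinM opprK; congr (_%:E).
  have l0 : lambda != 0 by rewrite gt_eqF.
  have lp0 : lambda + p != 0 by rewrite gt_eqF.
  rewrite expR_pM.
  by field; rewrite l0 lp0 gt_eqF.
- apply/measurable_EFinP; apply: measurable_funTS.
  by apply: measurable_funM => //; exact: measurable_expM.
- by move=> x _; rewrite lee_fin mulr_ge0 ?expR_ge0// oppr_ge0 ltW.
- by rewrite lee_fin invr_ge0 mulr_ge0// ltW.
Qed.

(** By [pE] the body has mass $1-(e^{pM}-1)/(pM)=1-1/(\lambda M)$, the complement of the tail
    mass. *)
Lemma integral_buffer_pdf : (\int[lebesgue_measure]_x (g x)%:E = 1)%E.
Proof.
have l0 : lambda != 0 by rewrite gt_eqF.
have M0 : M != 0 by rewrite gt_eqF.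
have p0 : p != 0 by rewrite lt_eqF.
rewrite (@ge0_integral_two_pieces _ `]0, M] `]M, +oo[ g body tail)//.
- have -> : (\int[lebesgue_measure]_(x in `]M, +oo[) (tail x)%:E =
      (1 / (lambda * M))%:E)%E.
    rewrite -integral_buffer_pdf_tail; apply: eq_integral => x.
    rewrite inE/= in_itv/= andbT => Mx.
    rewrite buffer_pdfE !patchE !mem_setE !in_itv/= andbT Mx leNgt Mx andbF.
    by rewrite add0r.
  have := @integral_exp2 R M^-1 (- (M^-1 / p)) p 0 0 0 M (ltW M_gt0).
  under eq_integral => x _.
    rewrite (_ : _ + _ = body x); last by rewrite /body; field; rewrite M0 p0.
    over.
  move=> ->; rewrite -EFinD; congr (_%:E).
  rewrite !mulr0 !mul0r expR0.
  rewrite expR_pM.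
  by field; rewrite l0 M0 p0.
- by move=> x /=; rewrite in_itv/= => /andP[/ltW/body_ge0].
- exact: buffer_pdfE.
Qed.

Let f := exponential_pdf lambda.
Let T (b : R) := b - uplink_power M b.

(** The factor $f(y-T(b))$ vanishes unless $T(b)\le y$. This cuts the integral down to
    $(0,\min(y,M)]$ and $(M,M+y]$, where the integrands are exponential polynomials. *)
Lemma stationary_density_equation (y : R) :
  (\int[lebesgue_measure]_b (f (y - T b) * g b)%:E = (g y)%:E)%E.
Proof.
have l0 : lambda != 0 by rewrite gt_eqF.
have M0 : M != 0 by rewrite gt_eqF.
have p0 : p != 0 by rewrite lt_eqF.
have lp0 : lambda + p != 0 by rewrite gt_eqF.
have [y0|y0] := leP y 0.
  (* For $y\le 0$ both sides vanish: [g] charges only $b>0$, and then $T(b)>0\ge y$. *)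
  rewrite {2}/g /buffer_pdf y0; apply: integral0_eq => b _.
  have [b0|b0] := leP b 0; first by rewrite /g /buffer_pdf b0 mulr0.
  rewrite /f lt0_exponential_pdf ?mul0r// /T /uplink_power.
  by case: (ltP M b) => Mb; rewrite ?mulr1 ?mulr0; lra.
pose m := Num.min y M.
pose k1 (b : R) := lambda * expR (- lambda * (y - b)) * body b.
pose k2 (b : R) := lambda * expR (- lambda * (y - b + M)) * tail b.
have my : m <= y by rewrite ge_min lexx.
have mM : m <= M by rewrite ge_min lexx orbT.
have k1_ge0 (b : R) : `]0, m]%classic b -> 0 <= k1 b.
  rewrite /= in_itv/= => /andP[/ltW/body_ge0 b0 _].
  by rewrite mulr_ge0// mulr_ge0 ?expR_ge0// ltW.
have k2_ge0 (b : R) : 0 <= k2 b.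
  by rewrite mulr_ge0// mulr_ge0 ?expR_ge0// ltW.
have mk1 : measurable_fun setT k1.
  apply: measurable_funM => //; apply: measurable_funM => //.
  apply: (measurableT_comp (measurable_expM _)).
  exact: measurable_funB.
have mk2 : measurable_fun setT k2.
  apply: measurable_funM => //; apply: measurable_funM => //.
  apply: (measurableT_comp (measurable_expM _)).
  by apply: measurable_funD => //; exact: measurable_funB.
have kE (b : R) : f (y - T b) * g b =
    (k1 \_ `]0, m]) b + (k2 \_ `]M, (M + y)]) b.
  rewrite buffer_pdfE !patchE !mem_setE !in_itv/= andbT le_min.
  rewrite /T /uplink_power; case: (ltP M b) => Mb.
    rewrite !andbF /= !add0r mulr1.
    case: (leP b (M + y)) => bMy.
      have by0 : 0 <= y - (b - M) by lra.
      by rewrite /f (exponential_pdfE lambda by0) /k2 opprB addrCA addrC.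
    by rewrite /f lt0_exponential_pdf ?mul0r//; lra.
  rewrite !andbT /= mulr0 subr0 !addr0.
  case: (ltP 0 b) => b0 /=; last by rewrite mulr0.
  case: (leP b y) => by0.
    have yb : 0 <= y - b by rewrite subr_ge0.
    by rewrite /f (exponential_pdfE lambda yb).
  by rewrite /f lt0_exponential_pdf ?mul0r// subr_lt0.
rewrite (@ge0_integral_two_pieces _ `]0, m] `]M, (M + y)] _ k1 k2)//.
(* [a1], [b1] and [b2] are the coefficients of the antiderivatives of [k1] and [k2], as
   [integral_exp2] expects them. *)
pose a1 := M^-1 * expR (- lambda * y).
pose b1 := - (lambda / (lambda + p)) * a1.
pose b2 := C * lambda / (lambda + p) * expR (- lambda * (y + M)).
have -> : (\int[lebesgue_measure]_(b in `]0%R, m]) (k1 b)%:E =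
    (a1 * expR (lambda * m) + b1 * expR ((lambda + p) * m) - (a1 + b1))%:E)%E.
  have m0 : 0 <= m by rewrite le_min !ltW.
  have := @integral_exp2 R 0 a1 lambda b1 (lambda + p) 0 m m0.
  rewrite !mulr0 !mul0r !add0r !expR0 !mulr1 => <-.
  apply: eq_integral => b _; congr (_%:E); rewrite /k1 /body /b1 /a1.
  have -> : - lambda * (y - b) = - lambda * y + lambda * b by ring.
  have -> : (lambda + p) * b = lambda * b + p * b by ring.
  by rewrite !expRD; field; rewrite lp0 M0.
have -> : (\int[lebesgue_measure]_(b in `]M, (M + y)%R]) (k2 b)%:E =
    (b2 * expR ((lambda + p) * (M + y)) - b2 * expR ((lambda + p) * M))%:E)%E.
  have My : M <= M + y by rewrite lerDl ltW.
  have := @integral_exp2 R 0 0 0 b2 (lambda + p) M (M + y) My.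
  rewrite !mul0r !add0r => <-.
  apply: eq_integral => b _; congr (_%:E); rewrite /k2 /tail /b2.
  have -> : - lambda * (y - b + M) = - lambda * (y + M) + lambda * b by ring.
  have -> : (lambda + p) * b = lambda * b + p * b by ring.
  by rewrite mul0r !add0r !expRD; field; rewrite lp0.
rewrite -EFinD; congr (_%:E).
rewrite /b2 /b1 /a1 /m /g /buffer_pdf leNgt y0 /=.
(* All exponentials are reduced to those of $\lambda y$, $\lambda M$ and $py$, with $e^{pM}$
   replaced by $(\lambda+p)/\lambda$. The identity is then rational in each branch of [g]. *)
have ly0 : expR (lambda * y) != 0 by rewrite gt_eqF// expR_gt0.
have lM0 : expR (lambda * M) != 0 by rewrite gt_eqF// expR_gt0.
have -> : expR (- lambda * y) = (expR (lambda * y))^-1.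
  by rewrite -expRN mulNr.
have -> : expR (- lambda * (y + M)) =
    (expR (lambda * y))^-1 * (expR (lambda * M))^-1.
  by rewrite -!expRN -expRD; congr expR; ring.
have -> : expR ((lambda + p) * (M + y)) = expR (lambda * M) *
    ((lambda + p) / lambda) * expR (lambda * y) * expR (p * y).
  by rewrite -expR_pM -!expRD; congr expR; ring.
have eq_exp (t : R) :
    expR ((lambda + p) * t) = expR (lambda * t) * expR (p * t).
  by rewrite -expRD; congr expR; ring.
rewrite !eq_exp expR_pM /C.
case: (leP y M) => yM; rewrite ?expR_pM.
  by field; rewrite lp0 M0 l0 ly0 lM0.
by field; rewrite lp0 M0 l0 ly0 lM0.
Qed.

End stationary_density.


(** * The laws of the process are the iterates of [next_law] *)

Section buffer_law.
Variables (R : realType) (d : measure_display) (Omega : measurableType d).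
Variables (P : probability Omega R) (M : R) (X B : nat -> {RV P >-> R}).
Variable nu : probability R R.
Hypothesis X_indep : mutually_independent X.
Hypothesis X_law : forall (i : nat) (A : set R), measurable A ->
  P (X i @^-1` A) = nu A.
Hypothesis B0_indep : independent_of_sequence (B 0%N) X.
Hypothesis B_rec : forall i w, B i.+1 w = storage_step M (B i w) (X i w).

Let mu (n : nat) := law_at M nu (distribution P (B 0%N)) n.

Let cylinder (J : {fset nat}) (C : nat -> set R) : set Omega :=
  \bigcap_(i in [set` J]) (X i @^-1` C i).

Let measurable_cylinder (J : {fset nat}) (C : nat -> set R) :
  (forall i, measurable (C i)) -> measurable (cylinder J C).
Proof.
move=> mC; apply: fin_bigcap_measurable; first exact: finite_fset.
by move=> i _; rewrite -[X in measurable X]setTI; exact: measurable_funPT.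
Qed.

(** The law of [B n] alone does not carry the induction: the step also needs independence of [B n]
    from [X n] and from later inputs. Hence the cylinder over indices at least [n]. *)
Lemma buffer_law_indep (n : nat) (A : set R) (J : {fset nat})
    (C : nat -> set R) : measurable A -> (forall i, measurable (C i)) ->
  (forall j, j \in J -> (n <= j)%N) ->
  P (B n @^-1` A `&` cylinder J C) = (mu n A * \prod_(j <- J) nu (C j))%E.
Proof.
move=> mA mC; elim: n A J C mA mC => [|n IH] A J C mA mC nJ.
  rewrite B0_indep//; last first.
    apply: (@fin_bigcap_measurable _ (g_sigma_algebraType
      [set D | exists i (A : set R), measurable A /\ D = X i @^-1` A])).
      exact: finite_fset.
    by move=> i _; apply: sub_sigma_algebra; exists i, (C i).
  rewrite X_indep//; congr (_ * _)%E.
  by apply: eq_bigr => i _; exact: X_law.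
have mD := measurable_cylinder J mC.
pose BX (w : Omega) : R * R := (B n w, X n w).
have mBX : measurable_fun setT BX.
  by apply/measurable_fun_pairP; split; exact: measurable_funPT.
(* The law of [(B n, X n)] restricted to the cylinder event, of total mass at most $1$. It agrees
   with the product of [mu n] and [c] times [nu] on rectangles, hence everywhere. *)
pose joint0 : {measure set (R * R) -> \bar R} := pushforward (mrestr P mD) BX.
pose joint := joint0 mBX.
pose c := (\prod_(j <- J) nu (C j))%E.
have c0 : (0 <= c)%E by apply: prode_ge0 => j _; exact: measure_ge0.
have cfin : c \is a fin_num.
  by apply: prode_fin_num => j _; exact: fin_num_measure.
have fc0 : 0 <= fine c by rewrite fine_ge0.
pose k : {nonneg R} := NngNum fc0.
have nJn : n \notin J by apply/negP => /nJ; rewrite ltnn.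
have rect (E F : set R) : measurable E -> measurable F ->
    joint (E `*` F) = (mu n E * mscale k nu F)%E.
  move=> mE mF.
  (* All indices of [J] exceed [n], so the condition on [X n] fits into the cylinder as a new
     coordinate. *)
  pose C' j := if j == n then F else C j.
  transitivity (P (B n @^-1` E `&` cylinder (n |` J)%fset C')).
    congr (P _); rewrite /cylinder bigcap_fsetU1 /C' eqxx.
    rewrite setIA; congr (_ `&` _).
    apply: eq_bigcapr => i /= iJ; case: eqP => // iE.
    by move: nJn; rewrite -iE iJ.
  rewrite IH//; last 2 first.
  - by move=> i; rewrite /C'; case: eqP.
  - by move=> j; rewrite in_fset1U => /predU1P[->//|/nJ/ltnW].
  congr (_ * _)%E; rewrite big_fsetU1//= /C' eqxx /mscale/= muleC.
  rewrite fineK// /c; congr (_ * _)%E.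
  by apply: eq_big_seq => i iJ; case: eqP => // iE; move: nJn; rewrite -iE iJ.
have mS : measurable (@storage_step2 R M @^-1` A).
  by rewrite -[X in measurable X]setTI; exact: measurable_storage_step2.
transitivity (joint (@storage_step2 R M @^-1` A)).
  congr (P (_ `&` _)); apply/funext => w; apply/propext.
  by rewrite /preimage/= B_rec.
rewrite -(@product_measure_unique _ _ _ _ _ (mu n) (mscale k nu) joint rect)//.
rewrite -[X in _ = (_ * X)%E](fineK cfin) muleC.
rewrite /mu /law_at iterS -/(law_at _ _ _ _).
rewrite [in RHS]/next_law /distribution/= /pushforward/= /product_measure1/=.
rewrite -ge0_integralZl//.
exact: measurable_fun_xsection.
Qed.

Lemma buffer_law (n : nat) (A : set R) : measurable A ->
  distribution P (B n) A = mu n A.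
Proof.
move=> mA; have := @buffer_law_indep n A fset0 (fun=> setT) mA.
rewrite big_seq_fset0 mule1 => <- //.
by rewrite /cylinder bigcap_fset big_seq_fset0 setIT.
Qed.

End buffer_law.


(** * Stationarity of the law with the explicit density *)

Section stationary_law_of_density.
Variables (R : realType) (M lambda p : R) (nu pi : probability R R).
Hypotheses (M_gt0 : 0 < M) (lambda_gt0 : 0 < lambda) (p_lt0 : p < 0).
Hypothesis pE : lambda * expR (p * M) = lambda + p.
Hypothesis nu_exp : has_pdf nu (exponential_pdf lambda).
Hypothesis pi_pdf : has_pdf pi (buffer_pdf M lambda p).

(** The mass of [A] after one step is a double integral over the old state [b] and the new state
    [y]. Tonelli puts the integral over [b] inside, where [stationary_density_equation] evaluates it
    to the density at [y]. *)
Lemma next_law_buffer_pdf (A : set R) : measurable A ->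
  next_law M nu pi A = pi A.
Proof.
move=> mA.
pose phi : R -> R := \1_A.
have uphi : unit_valued phi by exact: unit_valued_indic.
have [mphi phi01] := uphi.
have phi0 (x : R) : 0 <= phi x by have /andP[] := phi01 x.
have [mg g0 piA] := pi_pdf.
have [mf f0 _] := nu_exp.
pose g := buffer_pdf M lambda p; pose f := exponential_pdf lambda.
pose T (b : R) := b - uplink_power M b.
have mT : measurable_fun setT T.
  apply: measurable_funB => //; apply: measurable_funM => //.
  have mnat : measurable_fun setT (fun b : bool => b%:R : R) by [].
  by apply: (measurableT_comp mnat); exact: measurable_fun_ltr.
transitivity (\int[next_law M nu pi]_x (phi x)%:E)%E.
  by rewrite integral_indic// setIT.
rewrite ge0_integral_next_law; last 2 first.
- exact/measurable_EFinP.
- by move=> x; rewrite lee_fin.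
transitivity (\int[pi]_b (storage_op M nu phi b)%:E)%E.
  by apply: eq_integral => b _; rewrite shift_meanE.
have [mop op01] := unit_valued_storage_op M nu uphi.
rewrite (ge0_integral_has_pdf pi_pdf); last 2 first.
- exact/measurable_EFinP.
- by move=> x; rewrite lee_fin; have /andP[] := op01 x.
pose F (z : R * R) : \bar R := (phi z.2 * (f (z.2 - T z.1) * g z.1))%:E.
have F0 z : (0 <= F z)%E by rewrite lee_fin !mulr_ge0.
have mF : measurable_fun setT F.
  apply/measurable_EFinP; apply: measurable_funM.
    by apply: (measurableT_comp mphi); exact: measurable_snd.
  apply: measurable_funM; last first.
    by apply: (measurableT_comp mg); exact: measurable_fst.
  apply: (measurableT_comp mf); apply: measurable_funB.
    exact: measurable_snd.
  by apply: (measurableT_comp mT); exact: measurable_fst.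
transitivity (\int[lebesgue_measure]_b \int[lebesgue_measure]_y F (b, y))%E.
  apply: eq_integral => b _.
  rewrite shift_meanE// (ge0_integral_has_pdf_shift (T b) nu_exp)//.
  rewrite -ge0_integralZr//.
  - by apply: eq_integral => y _; rewrite -!EFinM /F/= mulrA.
  - apply/measurable_EFinP; apply: measurable_funM => //.
    by apply: (measurableT_comp mf); exact: measurable_funD.
  - by move=> y _; rewrite -EFinM lee_fin mulr_ge0.
  - by rewrite lee_fin.
rewrite (@fubini_tonelli _ _ (measurableTypeR R) (measurableTypeR R) R
  lebesgue_measure lebesgue_measure F)//.
rewrite piA// [RHS]integral_mkcond.
apply: eq_integral => y _.
transitivity ((phi y)%:E *
    \int[lebesgue_measure]_b (f (y - T b) * g b)%:E)%E.
  rewrite -ge0_integralZl//.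
  - apply/measurable_EFinP; apply: measurable_funM => //.
    apply: (measurableT_comp mf); apply: measurable_funB => //.
  - by move=> b _; rewrite lee_fin mulr_ge0.
  - by rewrite lee_fin.
rewrite stationary_density_equation// -EFinM /phi indicE patchE.
by case: (y \in A); rewrite ?mul1r ?mul0r.
Qed.

Lemma stationary_law_buffer_pdf : stationary_law M nu pi.
Proof.
have [mg g0 piA] := pi_pdf.
split=> [|n A mA].
  rewrite /on_state_space piA// -(probability_setT pi) piA//.
  rewrite [LHS]integral_mkcond; apply: eq_integral => x _; rewrite patchE.
  case: ifPn => //; rewrite mem_setE in_itv/= andbT -ltNge => x0.
  by rewrite /buffer_pdf (ltW x0).
elim: n A mA => // n IH A mA.
rewrite -[RHS]next_law_buffer_pdf// /law_at iterS -/(law_at _ _ _ _).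
rewrite /next_law /distribution /pushforward /= /product_measure1.
by apply: eq_measure_integral => B mB _; exact: IH.
Qed.

End stationary_law_of_density.

(** * The Lambert function and the final assembly *)

(** The choice in [lambertW0] meets its specification once a solution exists. The intermediate value
    theorem gives one on $[-1,0]$, since $\delta\le e^{\delta-1}$ means $-e^{-1}\le-\delta
    e^{-\delta}\le 0$. *)
Lemma lambertW0_spec (R : realType) (delta : R) : 1 < delta ->
  let w := lambertW0 (- delta * expR (- delta)) in
  -1 <= w /\ w * expR w = - delta * expR (- delta).
Proof.
move=> d1 /=.
apply: (@xgetPex _ 0
  [set w : R | -1 <= w /\ w * expR w = - delta * expR (- delta)]).
have d0 : 0 < delta by exact: lt_trans d1.
have cf : {within `[-1, 0 : R], continuous (fun w : R => w * expR w)}.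
  apply: continuous_subspaceT => x; apply: cvgM; first exact: cvg_id.
  exact: continuous_expR.
have [| |w] := @IVT _ _ (-1) 0 (- delta * expR (- delta)) _ cf.
- by rewrite lerN10.
- rewrite mul0r mulN1r ge_min le_max.
  rewrite !mulNr lerN2 oppr_le0 mulr_ge0 ?expR_ge0 ?(ltW d0)// orbT andbT.
  rewrite -ler_pdivlMr ?expR_gt0// -expRN opprK -expRD.
  apply/orP; left; apply: le_trans (expR_ge1Dx _).
  lra.
rewrite in_itv/= => /andP[w1 _] wE; by exists w.
Qed.


Theorem corollary1 (R : realType) (d : measure_display)
    (Omega : measurableType d) (P : probability Omega R)
    (M Xbar lambda delta p : R) (X B : nat -> {RV P >-> R})
    (M_gt0 : 0 < M) (Xbar_gt0 : 0 < Xbar)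
    (lambdaE : lambda = Xbar^-1) (deltaE : delta = lambda * M)
    (pE : p = (- delta - lambertW0 (- delta * expR (- delta))) / M)
    (X_indep : mutually_independent X)
    (X_exp : forall i, has_pdf (distribution P (X i)) (exponential_pdf lambda))
    (X_mean : forall i, ('E_P[X i] = Xbar%:E)%E)
    (B0_ge0 : forall w, 0 <= B 0%N w)
    (B0_indep : independent_of_sequence (B 0%N) X)
    (B_rec : forall i w, B i.+1 w = storage_step M (B i w) (X i w))
    (M_gt_Xbar : Xbar < M) :
  [/\ p < 0,
      lambda * expR (p * M) = lambda + p,
      - p / (M * (lambda + p)) = - p / (delta * expR (p * M)),
      exists pi : probability R R, limiting_law M (distribution P (X 0%N)) pi &
      forall pi : probability R R, limiting_law M (distribution P (X 0%N)) pi ->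
        [/\ has_pdf pi (buffer_pdf M lambda p),
            tv_dist (distribution P (B i)) pi @[i --> \oo] --> (0 : R) &
            pi [set b | uplink_power M b = M] = (1 / delta)%:E]].
Proof.
have lambda_gt0 : 0 < lambda by rewrite lambdaE invr_gt0.
have lambdaM_gt1 : 1 < lambda * M.
  by rewrite lambdaE mulrC ltr_pdivlMr// mul1r.
have delta_gt1 : 1 < delta by rewrite deltaE.
have [w_ge wE] := lambertW0_spec delta_gt1.
set w := lambertW0 _ in pE w_ge wE.
(* The branch condition $w\ge -1>-\delta$ excludes the trivial solution $w=-\delta$, which would
   give $p=0$. *)
have p_lt0 : p < 0.
  by rewrite pE pmulr_llt0 ?invr_gt0//; lra.
have pM : p * M = - delta - w by rewrite pE divfK// gt_eqF.
have p_eq : lambda * expR (p * M) = lambda + p.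
  (* After multiplication by $M$, both sides equal $-w$: the left one is $\delta e^{-\delta}e^{-w}$,
     and $\delta e^{-\delta}=-we^{w}$. *)
  apply: (mulIf (lt0r_neq0 M_gt0)).
  rewrite [RHS]mulrDl pM -deltaE addrA subrr add0r mulrAC -deltaE expRD.
  rewrite mulrA -[delta * _]opprK -mulNr -wE mulNr -mulrA -expRD subrr expR0.
  by rewrite mulr1.
have nuX (i : nat) (A : set R) : measurable A ->
    P (X i @^-1` A) = distribution P (X 0%N) A.
  move=> mA; have [_ _ Ei] := X_exp i; have [_ _ E0] := X_exp 0%N.
  by rewrite E0// -Ei.
have nu_exp := X_exp 0%N.
have [pi0 pi0_pdf] := ex_probability_has_pdf
  (measurable_buffer_pdf lambda p M_gt0)
  (buffer_pdf_ge0 M_gt0 lambda_gt0 p_lt0 p_eq)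
  (integral_buffer_pdf M_gt0 lambda_gt0 p_lt0 p_eq).
have tv_cvg := storage_tv_cvg M_gt0 lambda_gt0 lambdaM_gt1 nu_exp.
have pi0_stat :=
  stationary_law_buffer_pdf M_gt0 lambda_gt0 p_lt0 p_eq nu_exp pi0_pdf.
have pi0_state : on_state_space pi0 by have [] := pi0_stat.
split => //.
- by rewrite deltaE [lambda * M * _]mulrAC p_eq [M * _]mulrC.
- exists pi0; split => //; exists pi0; split => //.
  exact: (tv_cvg _ _ pi0_state pi0_stat).
move=> pi [pi_stat _].
(* A limiting law is in particular stationary, so uniqueness identifies it with the law built from
   the density. *)
have piE (A : set R) : measurable A -> pi A = pi0 A.
  exact: (stationary_law_unique M_gt0 lambda_gt0 lambdaM_gt1 nu_exp).
have [mg g_ge0 pi0E] := pi0_pdf.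
have B0_state : on_state_space (distribution P (B 0%N)).
  rewrite /on_state_space -(probability_setT P); congr (P _).
  by apply/seteqP; split => // x _ /=; rewrite in_itv/= andbT.
split.
- by split => // A mA; rewrite piE// pi0E.
- rewrite (_ : (fun i => _) = (fun i => tv_dist
      (law_at M (distribution P (X 0%N)) (distribution P (B 0%N)) i) pi)).
    exact: (tv_cvg _ _ B0_state pi_stat).
  apply/funext => i; apply: eq_tv_distl => A mA.
  exact: (buffer_law X_indep nuX B0_indep B_rec).
(* As $M\ne 0$, transmission at power $M$ happens exactly when $b>M$, so its probability is the tail
   mass. *)
rewrite (_ : [set b | _] = `]M, +oo[%classic).
  by rewrite piE// pi0E// integral_buffer_pdf_tail// deltaE.
apply/seteqP; split => b /=; rewrite in_itv/= andbT /uplink_power.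
  case: (M < b) => //= /eqP; rewrite mulr0 eq_sym.
  by rewrite gt_eqF.
by move=> ->; rewrite mulr1.
Qed.
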